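(* Let $k>0$ be an integer. There exists a polynomial $Q_k$ such that every graph $G$ on $n$ vertices containing neither $P_k$ nor its complement $\overline{P_k}$ as an induced subgraph admits a CS-separator of size at most $Q_k(n)$.
   Context: $P_k$ denotes the path on $k$ vertices and $\overline{P_k}$ its complement. A cut of a graph $G=(V,E)$ is a pair $(A,B)$ with $A\cup B=V$ and $A\cap B=\emptyset$; it separates a clique $K$ and a stable set $S$ if $K\subseteq A$ and $S\subseteq B$. A CS-separator of $G$ is a family of cuts such that for every clique $K$ and every stable set $S$ of $G$ with $K\cap S=\emptyset$, some cut of the family separates $K$ and $S$. *)

(* Defs.v *)
From mathcomp Require Import all_boot all_order all_algebra.

Set Implicit Arguments.
Unset Strict Implicit.
Unset Printing Implicit Defensive.

Record graph : Type := Graph {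
  vertex :> finType;
  edge : rel vertex;
  edge_sym : symmetric edge;
  edge_irrefl : irreflexive edge
}.

Section Complement.
Variable G : graph.

Definition co_edge : rel G := fun x y => (x != y) && ~~ edge x y.

Lemma co_edge_sym : symmetric co_edge.
Proof. by move=> x y; rewrite /co_edge eq_sym edge_sym. Qed.

Lemma co_edge_irrefl : irreflexive co_edge.
Proof. by move=> x; rewrite /co_edge eqxx. Qed.

Definition complement : graph := Graph co_edge_sym co_edge_irrefl.

End Complement.

Section PathGraph.
Variable k : nat.

Definition path_edge : rel 'I_k :=
  fun i j => (i.+1 == j :> nat) || (j.+1 == i :> nat).

Lemma path_edge_sym : symmetric path_edge.
Proof. by move=> i j; rewrite /path_edge orbC. Qed.

Lemma path_edge_irrefl : irreflexive path_edge.
Proof. by move=> i; rewrite /path_edge orbb gtn_eqF. Qed.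

(* k is the number of vertices, not of edges. *)
Definition path_graph : graph := Graph path_edge_sym path_edge_irrefl.

End PathGraph.

Definition contains_induced (G H : graph) : Prop :=
  exists f : H -> G,
    injective f /\ forall x y : H, edge (f x) (f y) = edge x y.

Section CSSeparator.
Variable G : graph.

Definition clique (K : {set G}) : Prop :=
  forall x y : G, x \in K -> y \in K -> x != y -> edge x y.

Definition stable_set (S : {set G}) : Prop :=
  forall x y : G, x \in S -> y \in S -> ~~ edge x y.

Definition is_cut (c : {set G} * {set G}) : Prop :=
  c.1 :|: c.2 = [set: G] /\ c.1 :&: c.2 = set0.

Definition separates (c : {set G} * {set G}) (K S : {set G}) : Prop :=
  K \subset c.1 /\ S \subset c.2.

Definition CS_separator (F : {set {set G} * {set G}}) : Prop :=
  (forall c, c \in F -> is_cut c) /\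
  forall K S : {set G}, clique K -> stable_set S -> K :&: S = set0 ->
    exists2 c, c \in F & separates c K S.

End CSSeparator.

(* Main.v *)
(* A graph [G] without induced [P_k] and its complement has, in every vertex set
   [X] with at least two elements, two sets of size at least [|X| / N] that are
   completely adjacent or completely non-adjacent; deleting either of them gives
   a recursion [f n <= 2 * f ((1 - 1 / N) * n)] for the number of cuts, whose
   solution is polynomial.  To find the two sets, let [G'] be [G] or its
   complement.  Failure of a greedy embedding of [P_k] yields linear sets [A]
   and [B] such that each vertex of [A] has few [G']-neighbours in [B]; iterating inside
   [B], as in the proof of Ramsey's theorem, yields a linear set with few edges
   of [G'].  After deletion of its vertices of large degree, either it contains
   two linear sets with no edge of [G'] between them, or an induced path can be
   grown one vertex at a time while keeping a giant connected part attached to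
   its last vertex. *)
Require Import Defs.
From mathcomp Require Import all_boot all_order all_algebra.
From mathcomp Require Import zify.
Import Order.TTheory GRing.Theory Num.Theory.
Set Implicit Arguments.
Unset Strict Implicit.
Unset Printing Implicit Defensive.

(** * Neighbourhoods and separated pairs of a finite relation *)

Section Finite.
Variable T : finType.
Implicit Types (A B C S X Y Z : {set T}) (r : rel T).

Definition trim n A : {set T} := [set x in take n (enum A)].

Lemma trim_sub n A : trim n A \subset A.
Proof. by apply/subsetP=> x; rewrite inE => /mem_take; rewrite mem_enum. Qed.

Lemma card_trim n A : n <= #|A| -> #|trim n A| = n.
Proof.
move=> leA; rewrite cardsE.
have /card_uniqP -> : uniq (take n (enum A)) by rewrite take_uniq ?enum_uniq.
by rewrite size_takel // -cardE.
Qed.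

Definition nbh r X x : {set T} := [set y in X | r x y].

Definition volume r X := \sum_(x in X) #|nbh r X x|.

Lemma nbh_sub r X x : nbh r X x \subset X.
Proof. by apply/subsetP=> y; rewrite inE => /andP[]. Qed.

Lemma nbhS r X Y x : X \subset Y -> nbh r X x \subset nbh r Y x.
Proof.
by move=> /subsetP XY; apply/subsetP=> y; rewrite !inE => /andP[/XY-> ->].
Qed.

Lemma sum_nbhC r X Y : symmetric r ->
  \sum_(x in X) #|nbh r Y x| = \sum_(y in Y) #|nbh r X y|.
Proof.
move=> rC; under eq_bigr do rewrite -sum1_card.
rewrite (exchange_big_dep (mem Y)) /=; last first.
  by move=> x y _; rewrite inE => /andP[].
apply: eq_bigr => y yY; rewrite -sum1_card; apply: eq_bigl => x.
by rewrite !inE yY rC.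
Qed.

(** Ordered pairs inside [X] number at most [m ^ 2], and so do those from [X] to [Y], hence by
    symmetry those from [Y] to [X]. *)
Lemma volumeU r X Y m : symmetric r -> [disjoint X & Y] -> #|X| = m ->
  (forall x, x \in X -> #|nbh r Y x| <= m) ->
  volume r (X :|: Y) <= 3 * m ^ 2 + volume r Y.
Proof.
move=> rC dXY cX degY.
have nU x : #|nbh r (X :|: Y) x| <= #|nbh r X x| + #|nbh r Y x|.
  rewrite (leq_trans _ (leq_card_setU _ _)) ?subset_leq_card //.
  by apply/subsetP=> y; rewrite !inE -andb_orl.
have XY : \sum_(x in X) #|nbh r Y x| <= m * m.
  by rewrite -{1}cX -sum_nat_const leq_sum.
have XX : \sum_(x in X) #|nbh r X x| <= m * m.
  rewrite -{1}cX -sum_nat_const leq_sum // => x _.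
  by rewrite -cX subset_leq_card ?nbh_sub.
rewrite /volume; apply: leq_trans (leq_sum _ (fun x _ => nU x)) _.
have sumU F : \sum_(x in X :|: Y) F x = \sum_(x in X) F x + \sum_(x in Y) F x.
  by rewrite -bigU //; apply: eq_bigl => x; rewrite !inE.
by rewrite big_split /= !sumU -(sum_nbhC X Y rC) /volume; lia.
Qed.

Definition separated r A B := [forall x in A, forall y in B, ~~ r x y].

Lemma separatedP r A B :
  reflect (forall x y, x \in A -> y \in B -> ~~ r x y) (separated r A B).
Proof.
apply: (iffP idP) => [/forall_inP AB x y xA|AB].
  by move/forall_inP: (AB x xA); apply.
by apply/forall_inP=> x xA; apply/forall_inP=> y; apply: AB.
Qed.

Definition has_separated r s X := [exists A : {set T}, exists B : {set T},
  [&& A \subset X, B \subset X, [disjoint A & B], s <= #|A|, s <= #|B|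
    & separated r A B]].

Lemma has_separatedP r s X : reflect
  (exists A B, [/\ A \subset X, B \subset X & [disjoint A & B]] /\
    [/\ s <= #|A|, s <= #|B| & separated r A B]) (has_separated r s X).
Proof.
apply: (iffP existsP) => [[A /existsP[B /and5P[AX BX dAB sA /andP[sB sAB]]]]|].
  by exists A, B.
case=> A [B [[AX BX dAB] [sA sB sAB]]]; exists A; apply/existsP; exists B.
by apply/and5P; split=> //; apply/andP.
Qed.

Lemma has_separatedS r s X Y : X \subset Y ->
  has_separated r s X -> has_separated r s Y.
Proof.
move=> XY /has_separatedP[A [B [[AX BX dAB] sAB]]].
by apply/has_separatedP; exists A, B; split=> //; split=> //; apply: subset_trans XY.
Qed.

(** * Connected sets and the growth of induced paths *)

Definition connected r X := forall A B, A :|: B = X -> [disjoint A & B] ->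
  A != set0 -> B != set0 -> exists x y, [/\ x \in A, y \in B & r x y].

(* [Z] is inclusion-minimal among the unions of components missing fewer than
   [s] points; a splitting of [Z] would have two parts of size less than [s]. *)
Lemma connected_large r s X : symmetric r -> 0 < s -> 3 * s <= #|X| ->
  ~ has_separated r s X ->
  exists Z, [/\ Z \subset X, connected r Z, #|X| < #|Z| + s
              & separated r Z (X :\: Z)].
Proof.
move=> rC s_gt0 leX nsep.
pose P Z := [&& Z \subset X, #|X :\: Z| < s & separated r Z (X :\: Z)].
have PX : P X.
  rewrite /P subxx setDv cards0 s_gt0; apply/separatedP=> x y _.
  by rewrite inE.
have [Z /minsetP[/and3P[ZX cZ /separatedP sZ] minZ] _] := minset_exists PX.
have cardZ : #|X :\: Z| + #|Z| = #|X|.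
  by rewrite addnC (cardsD X Z) (setIidPr ZX) subnKC // subset_leq_card.
exists Z; split=> //; [|by lia|exact/separatedP].
have small A B : A :|: B = Z -> [disjoint A & B] -> B != set0 ->
    separated r A B -> #|A| < s.
  move=> ABZ dAB B0 /separatedP sAB; rewrite ltnNge; apply/negP=> leA.
  have AZ : A \subset Z by rewrite -ABZ subsetUl.
  have sA : separated r A (X :\: A).
    apply/separatedP=> x y xA; rewrite inE => /andP[yA yX].
    have [yZ|yZ] := boolP (y \in Z); last by rewrite sZ ?(subsetP AZ) // inE yZ.
    by apply: sAB => //; move: yZ; rewrite -ABZ inE (negPf yA).
  (* [A] has no edge to the rest of [X]. If that rest has [s] points there is a forbidden pair;
     otherwise [A] satisfies [P], and minimality gives [A = Z], leaving nothing for [B]. *)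
  have [leXA|ltXA] := leqP s #|X :\: A|.
    apply: nsep; apply/has_separatedP; exists A, (X :\: A); split=> //; split=> //.
    - exact: subset_trans ZX.
    - exact: subsetDl.
    - by rewrite disjoint_sym disjoints_subset; apply/subsetP=> x; rewrite !inE => /andP[].
  have /minZ eqAZ : P A by rewrite /P ltXA sA (subset_trans AZ).
  case/set0Pn: B0 => x xB; have : x \in A by rewrite eqAZ // -ABZ inE xB orbT.
  by rewrite (disjointFl dAB).
move=> A B ABZ dAB A0 B0.
have [sAB|] := boolP (separated r A B).
  have sBA : separated r B A.
    by apply/separatedP=> x y xB yA; rewrite rC (separatedP _ _ _ sAB).
  have ltA := small _ _ ABZ dAB B0 sAB.
  have ltB : #|B| < s by apply: small A0 sBA; rewrite 1?setUC 1?disjoint_sym.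
  by have := (leq_card_setU A B).1; rewrite ABZ; lia.
rewrite negb_forall_in => /exists_inP[x xA]; rewrite negb_forall_in.
by case/exists_inP=> y yB /negPn rxy; exists x, y.
Qed.

(** Delete [v] and its neighbours, keep a giant connected piece [Z] of the rest, and continue from a
    neighbour [x] of [v] attached to [Z], inside [x |: Z]. A step costs at most [D + s + 1] points;
    the reserve [3 * s] keeps [connected_large] applicable. Here [n] counts the edges of the
    path. *)
Lemma induced_path_from r D s n X v : symmetric r -> irreflexive r -> 0 < s ->
  (forall x, x \in X -> #|nbh r X x| <= D) -> ~ has_separated r s X ->
  connected r X -> v \in X -> n * (D + s + 1) + 3 * s <= #|X| ->
  exists p : nat -> T, [/\ p 0 = v, forall i, i <= n -> p i \in X
    & forall i j, i < j <= n ->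
        p i != p j /\ r (p i) (p j) = (j == i.+1)].
Proof.
move=> rC rI s_gt0; elim: n X v => [|n IH] X v degX nsep conX vX leX.
  by exists (fun=> v); split=> // i j; lia.
pose Y := X :\: (v |: nbh r X v).
have YX : Y \subset X by apply: subsetDl.
have leY : #|X| <= #|Y| + D + 1.
  have := (leq_card_setU Y (v |: nbh r X v)).1.
  have := subset_leq_card (_ : X \subset Y :|: (v |: nbh r X v)).
  have := degX v vX; rewrite cardsU1.
  set c := #|_ :|: _| => ? /(_ _) h.
  have /h : X \subset Y :|: (v |: nbh r X v).
    by apply/subsetP=> x xX; rewrite !inE xX andbT orNb.
  by case: (_ \notin _); lia.
have nsepY : ~ has_separated r s Y by move=> /(has_separatedS YX).
have [|Z [ZY conZ leZ /separatedP sZ]] := connected_large rC s_gt0 _ nsepY; first by lia.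
have ZX := subset_trans ZY YX.
have Z0 : Z != set0 by rewrite -card_gt0; lia.
have vZ x : x \in Z -> [/\ x \in X, v != x & ~~ r v x].
  by move/(subsetP ZY); rewrite !inE negb_or => /andP[/andP[xv]] h xX;
     rewrite xX in h; rewrite eq_sym xv.
have [||||x [u [/setDP[xX xZ] uZ' rxu]]] := conX (X :\: Z) Z.
- by rewrite setUC -[Z in Z :|: _](setIidPr ZX) setID.
- by rewrite disjoints_subset; apply/subsetP=> x; rewrite !inE => /andP[].
- by apply/set0Pn; exists v; rewrite inE vX andbT; apply/negP=> /vZ[_]; rewrite eqxx.
- by [].
(* Otherwise [x] is [v], which has no neighbour in [Z], or lies in [Y :\: Z], which is separated
   from [Z]. *)
have rvx : r v x.
  apply: contraT => nvx; have [xv|xv] := eqVneq x v.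
    by case: (vZ u uZ') => _ _; rewrite -xv rxu.
  move: (sZ u x uZ'); rewrite rC rxu !inE xZ (negPf xv) (negPf nvx) xX /=.
  by move=> /(_ isT).
pose X' := x |: Z.
have X'X : X' \subset X by rewrite subUset sub1set xX.
have conX' : connected r X'.
  move=> A B ABX dAB A0 B0.
  wlog xA : A B ABX dAB A0 B0 / x \in A.
    move=> wl; have : x \in A :|: B by rewrite ABX setU11.
    rewrite inE => /orP[xA|xB]; first exact: wl.
    case: (wl B A); rewrite ?[B :|: A]setUC ?[[disjoint B & A]]disjoint_sym //.
    by move=> y [z [yB zA ryz]]; exists z, y; rewrite rC.
  have xB : x \notin B by rewrite (disjointFr dAB).
  have [A1|A1] := eqVneq (A :\ x) set0.
    exists x, u; split=> //.
    have : u \in A :|: B by rewrite ABX inE uZ' orbT.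
    rewrite inE => /orP[uA|//]; have : u \in A :\ x.
      by rewrite !inE uA andbT; apply: contraNneq xZ => <-.
    by rewrite A1 inE.
  have [||||y [z [/setD1P[_ yA] zB ryz]]] := conZ (A :\ x) B => //.
  - apply/setP=> y; have /setP/(_ y) := ABX; rewrite !inE.
    have [->|] //= := eqVneq y x.
    by rewrite (negPf xB) (negPf xZ).
  - by apply: disjointWl dAB; apply: subsetDl.
  by exists y, z.
have [|||p [p0 pX pP]] := IH X' x _ _ conX' (setU11 _ _).
- move=> y yX'; apply: leq_trans (degX y (subsetP X'X _ yX')).
  exact/subset_leq_card/nbhS.
- by move=> /(has_separatedS X'X).
- move: leX leY leZ; rewrite cardsU1 xZ mulSn; clear.
  by move: (n * _) #|X| #|Y| #|Z| => a b c d; lia.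
exists (fun i => if i is i'.+1 then p i' else v); split=> // [[|i] lei //|].
  by apply: (subsetP X'X); apply: pX.
move=> [|i] [|j] // /andP[ltij lejn]; last by apply: pP; rewrite -ltnS ltij.
case: j {ltij} lejn => [_|j lej].
  by rewrite p0 rvx; split=> //; apply: contraTneq rvx => ->; rewrite rI.
(* A vertex after [p 0 = x] differs from [x], so it lies in [Z], away from [v] and its
   neighbours. *)
have := pX j.+1 lej; rewrite inE; have [] := pP 0 j.+1; first by [].
rewrite p0 inE eq_sym => /negPf-> _ /= /vZ[_ -> /negPf->]; by split.
Qed.

End Finite.

(** * Greedy embedding, and subsets sparse in a graph or its complement *)

Section Graph.
Variable G : graph.
Implicit Types (A B U X Y : {set G}) (b : bool) (h : rel nat) (p : nat -> G).

(* Edges of [G] for [b = true], edges of its complement for [b = false]. *)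
Definition bedge b : rel G := fun x y => (x != y) && (edge x y == b).

Lemma bedge_sym b : symmetric (bedge b).
Proof. by move=> x y; rewrite /bedge eq_sym edge_sym. Qed.

Lemma bedge_irrefl b : irreflexive (bedge b).
Proof. by move=> x; rewrite /bedge eqxx. Qed.

Lemma bedgeN b x y : bedge (~~ b) x y = (x != y) && ~~ bedge b x y.
Proof. by rewrite /bedge; case: (x != y); case: edge; case: b. Qed.

Definition pattern h n p := forall i j, i < j < n -> bedge (h i j) (p i) (p j).

(** Choose in [V 0] a vertex keeping a fraction [1 / q] of every later [V i], and recurse; the power
    [q ^ n] pays for these shrinkings. If no vertex qualifies, pigeonhole over the indices [i] gives
    a set [A] of vertices that all fail at one [V i.+1]. *)
Lemma greedy_embedding q m n h (V : nat -> {set G}) X :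
    0 < q -> 0 < m -> X != set0 ->
    (forall i, i < n -> V i \subset X /\ #|V i| = q ^ n * m) ->
  (exists2 p, forall i, i < n -> p i \in V i & pattern h n p) \/
  (exists b A B, [/\ A \subset X, B \subset X, m <= #|B|, #|B| <= n * #|A|
     & forall x, x \in A -> q * #|nbh (bedge b) B x| <= #|B|]).
Proof.
move=> q_gt0 m_gt0 X0; elim: n h V => [|n IH] h V HV.
  left; case/set0Pn: X0 => x _.
  by exists (fun=> x) => // i j; rewrite ltn0 andbF.
have [V0X cV0] := HV 0 isT.
have qm_gt0 : 0 < q ^ n * m by rewrite muln_gt0 expn_gt0 q_gt0.
pose W v i := nbh (bedge (h 0 i.+1)) (V i.+1) v.
have [/exists_inP[v vV /forallP good]|] :=
    boolP [exists v in V 0, [forall i : 'I_n, q ^ n * m <= #|W v i|]].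
  have WV i : trim (q ^ n * m) (W v i) \subset V i.+1.
    exact: subset_trans (trim_sub _ _) (nbh_sub _ _ _).
  have [i ltin|[p pV pP]|[b [A [B [AX BX mB BA degA]]]]] := IH
    (fun i j => h i.+1 j.+1) (fun i => trim (q ^ n * m) (W v i)).
  - split; last by rewrite card_trim // (good (Ordinal ltin)).
    by apply: subset_trans (HV i.+1 _).1.
  - left; exists (fun i => if i is i'.+1 then p i' else v).
      by move=> [|i] // ltin; apply: (subsetP (WV i)); apply: pV.
    move=> [|i] [|j] //= ltj; last by apply: pP.
    by have /(subsetP (trim_sub _ _)) := pV j ltj; rewrite inE => /andP[].
  - right; exists b, A, B; split=> //; apply: leq_trans BA _.
    by rewrite leq_mul2r leqnSn orbT.
rewrite negb_exists_in => /forall_inP bad; right.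
pose Bad (i : 'I_n) := [set v in V 0 | #|W v i| < q ^ n * m].
have [i cBad] : exists i : 'I_n, #|V 0| <= n * #|Bad i|.
  apply/existsP; apply: contraT; rewrite negb_exists => /forallP small.
  have cov : V 0 \subset \bigcup_(i < n) Bad i.
    apply/subsetP=> v vV; have := bad v vV; rewrite negb_forall => /existsP[i].
    by rewrite -ltnNge => lti; apply/bigcupP; exists i; rewrite ?inE ?vV.
  have leV : #|V 0| <= \sum_(i < n) #|Bad i|.
    apply: leq_trans (subset_leq_card cov) _.
    elim/big_ind2: _ => [|c A d B leA leB|] //; first by rewrite cards0.
    exact: leq_trans (leq_card_setU A B).1 (leq_add leA leB).
  (* The predecessor carries the strict inequality [n * #|Bad i| < #|V 0|] through the sum. *)
  have : \sum_(i < n) n * #|Bad i| <= \sum_(i < n) #|V 0|.-1.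
    by apply: leq_sum => i _; have := small i; rewrite -ltnNge; lia.
  rewrite -big_distrr sum_nat_const card_ord /= => le2.
  have V0_gt0 : 0 < #|V 0| by rewrite cV0 expnS -mulnA muln_gt0 q_gt0.
  have [n0|n_gt0] := posnP n.
    by move: leV; rewrite big1 => [|[i lti] _]; [lia|have := lti; rewrite {1}n0].
  rewrite leq_pmul2l // in le2.
  by have := leq_trans leV le2; lia.
have [V1X cV1] := HV i.+1 (ltn_ord i).
exists (h 0 i.+1), (Bad i), (V i.+1); split=> //.
- by apply: subset_trans V0X; apply/subsetP=> x; rewrite inE => /andP[].
- by rewrite cV1 leq_pmull // expn_gt0 q_gt0.
- by rewrite cV1 -cV0 (leq_trans cBad) // leq_mul2r leqnSn orbT.
- move=> x; rewrite inE => /andP[_ /ltnW le]; rewrite cV1 expnS -mulnA.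
  by rewrite leq_mul2l le orbT.
Qed.

End Graph.

(* [a b] is the size, in units of [m], of the set wanted in [bedge b].  The extra
   parameter [K] makes the part [A] added in the induction step large compared
   with [m], so that [m] vertices of [A] remain outside the set found in [B]. *)
Lemma sparse_or_dense_subset k h n (a : bool -> nat) K :
  0 < k -> a true + a false = n ->
  exists2 C, 0 < C & forall (G : graph) (X : {set G}),
  (forall p : nat -> G, ~ pattern h k p) -> C <= #|X| ->
  exists m b (U : {set G}),
    [/\ #|X| <= C * m, K * m <= #|X|, U \subset X, #|U| = a b * m
                 & volume (bedge b) U <= 3 * a b * m ^ 2].
Proof.
move=> k_gt0; elim: n a K => [|n IH] a K.
  move=> /eqP; rewrite addn_eq0 => /andP[/eqP a1 _]; exists (2 * K.+1) => // G X _ leX.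
  exists (#|X| %/ K.+1), true, set0; rewrite a1 cards0 sub0set /volume big_set0.
  split=> //; nia.
move=> aS; pose a' b := fun c => if c == b then (a c).-1 else a c.
have [/existsP[b /eqP ab]|/existsPn ab] := boolP [exists b, a b == 0].
  exists (2 * K.+1) => // G X _ leX.
  exists (#|X| %/ K.+1), b, set0; rewrite ab cards0 sub0set /volume big_set0.
  split=> //; nia.
have a_gt0 b : 0 < a b by rewrite lt0n ab.
have a'S b : a' b true + a' b false = n.
  by have := a_gt0 true; have := a_gt0 false; rewrite /a'; case: b => /=; lia.
have [C1 C1_gt0 HC1] := IH (a' true) (K + k * n.+1) (a'S true).
have [C0 C0_gt0 HC0] := IH (a' false) (K + k * n.+1) (a'S false).
(* The colour [b] is known only after the embedding, which needs [q]; so [q] must serve both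
   colours. *)
pose q := C1 + C0.
have q_gt0 : 0 < q by rewrite addn_gt0 C1_gt0.
have HC (G : graph) b (B : {set G}) :
     (forall p : nat -> G, ~ pattern h k p) -> q <= #|B| ->
     exists m c (U : {set G}), [/\ #|B| <= q * m,
     (K + k * n.+1) * m <= #|B|, U \subset B, #|U| = a' b c * m
   & volume (bedge c) U <= 3 * a' b c * m ^ 2].
  move=> noP leB; case: b.
    have [|m [c [U [? ? ? ? ?]]]] := HC1 G B noP; first by rewrite /q in leB; lia.
    by exists m, c, U; split=> //; rewrite /q; nia.
  have [|m [c [U [? ? ? ? ?]]]] := HC0 G B noP; first by rewrite /q in leB; lia.
  by exists m, c, U; split=> //; rewrite /q; nia.
have qk_gt0 : 0 < q ^ k by rewrite expn_gt0 q_gt0.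
(* The factor [2] absorbs the rounding in [m0], [q ^ k] the shrinkings of the embedding, and the
   last [q] the passage from [B] to [m]. *)
exists (2 * q ^ k * q) => [|G X noP leX]; first by rewrite !muln_gt0 qk_gt0.
pose m0 := #|X| %/ q ^ k.
have leXm : #|X| <= 2 * q ^ k * m0.
  by have := ltn_ceil #|X| qk_gt0; rewrite -/m0 => ?; nia.
have qm0 : q <= m0 by rewrite /m0 leq_divRL //; nia.
have leV : q ^ k * m0 <= #|X| by rewrite mulnC leq_trunc_div.
have [||i _|[p _ /noP//]|[b [A [B [AX BX mB BA degA]]]]] :=
  @greedy_embedding G q m0 k h (fun=> trim (q ^ k * m0) X) X q_gt0.
- exact: leq_trans qm0.
- by rewrite -card_gt0; apply: leq_trans leV; rewrite muln_gt0 qk_gt0 (leq_trans q_gt0).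
- by rewrite trim_sub card_trim.
have [m [c [U [Bm mK UB cU vU]]]] := HC G b B noP (leq_trans qm0 mB).
have lenX : #|B| <= #|X| by apply: subset_leq_card.
have leXqm : #|X| <= 2 * q ^ k * q * m.
  by apply: leq_trans leXm _; rewrite -!mulnA !leq_mul2l (leq_trans mB Bm) !orbT.
have leKX : K * m <= #|X| by nia.
(* In the other colour [a'] agrees with [a] and [U] already suffices; in colour [b] it is short of
   [m] vertices, to be taken from [A]. *)
have [cb|cb] := eqVneq c b; last first.
  exists m, c, U; move: cU vU; rewrite /a' (negPf cb) => cU vU; split=> //.
  exact: subset_trans BX.
subst c; move: cU vU; rewrite /a' eqxx => cU vU.
have ltab : a b <= n.+1 by rewrite -aS; case: (b); lia.
have leA : a b * m <= #|A|.
  by rewrite -(leq_pmul2l k_gt0); apply: leq_trans BA; nia.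
have leAU : m <= #|A :\: U|.
  have := subset_leq_card (subsetIr A U); have := cardsID U A.
  have := a_gt0 b; rewrite cU; case: (a b) leA => // c; rewrite mulSn /=; lia.
have cA := card_trim leAU; have AAU := trim_sub m (A :\: U).
set A' := trim _ _ in cA AAU.
have dAU : [disjoint A' & U].
  by apply: disjointWl AAU _; rewrite disjoints_subset subsetDr.
exists m, b, (A' :|: U); split=> //.
- rewrite subUset (subset_trans UB BX) (subset_trans AAU) //.
  by rewrite (subset_trans (subsetDl _ _)).
- rewrite cardsU (disjoint_setI0 dAU) cards0 subn0 cA cU.
  by rewrite -mulSn prednK ?a_gt0.
- have := @volumeU _ (bedge b) A' U m (bedge_sym b) dAU cA.
  (* A vertex of [A] has at most [#|B| / q] neighbours in [B], and [#|B| <= q * m]. *)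
  have h1 : forall x, x \in A' -> #|nbh (bedge b) U x| <= m.
    move=> x /(subsetP AAU); rewrite inE => /andP[_ /degA le].
    rewrite -(leq_pmul2l q_gt0); apply: leq_trans Bm; apply: leq_trans le.
    by rewrite leq_mul2l subset_leq_card ?orbT // nbhS.
  move=> /(_ h1) le; apply: leq_trans le _; move: vU (a_gt0 b).
  by case: (a b) => // c /=; rewrite mulnS mulnDl => vU _; rewrite leq_add2l.
Qed.

(** * Forbidden paths and pure pairs *)

(* [P_k] is forbidden by [b = true], its complement by [b = false]. *)
Definition induced_path_free k (G : graph) := forall b (p : nat -> G),
  ~ pattern (fun i j => (j == i.+1) == b) k p.

Lemma induced_path_freeP k (G : graph) :
  ~ contains_induced G (path_graph k) ->
  ~ contains_induced G (complement (path_graph k)) -> induced_path_free k G.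
Proof.
move=> noP nocoP b p Hp.
have p_inj : injective (fun i : 'I_k => p i).
  have neq (i j : 'I_k) : i < j -> p i <> p j.
    move=> ltij eqp; have := Hp i j; rewrite ltij ltn_ord eqp => /(_ isT).
    by rewrite /bedge eqxx.
  move=> i j eqp; apply: val_inj => /=; have [/neq||//] := ltngtP i j => //.
  by move/neq => /(_ (esym eqp)).
have edgeE (i j : 'I_k) : i != j -> edge (p i) (p j) = (path_edge i j == b).
  wlog ltij : i j / i < j.
    move=> wl ij; have := ij; rewrite neq_ltn => /orP[/wl/(_ ij)//|/wl].
    by rewrite eq_sym edge_sym path_edge_sym => ->.
  move=> _; have := Hp i j; rewrite ltij ltn_ord => /(_ isT) /andP[_ /eqP->].
  by rewrite /path_edge (gtn_eqF (ltn_trans ltij (ltnSn j))) orbF [j == _ :> nat]eq_sym.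
case: b {Hp} edgeE => edgeE; [apply: noP|apply: nocoP]; exists (fun i : 'I_k => p i).
  split=> // i j; have [->|ij] := eqVneq i j; first by rewrite !edge_irrefl.
  by rewrite edgeE // eqb_id.
split=> // i j; have [->|ij] := eqVneq i j; first by rewrite !edge_irrefl.
by rewrite edgeE // eqbF_neg /= /co_edge ij.
Qed.

Lemma pure_pair k : 0 < k -> exists2 N, 0 < N &
  forall (G : graph) (X : {set G}), induced_path_free k G -> 1 < #|X| ->
  exists b (A B : {set G}),
    [/\ A \subset X, B \subset X, #|X| <= N * #|A|, #|X| <= N * #|B|
    & forall x y, x \in A -> y \in B -> bedge b x y].
Proof.
(* Half of [L * m] survives the removal of large degrees. These [(8 * k + 4) * m] vertices pay for
   [k.-1] path steps of cost [6 * m + m + 1 <= 8 * m], the reserve [3 * m], and the loss in passing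
   to [W]. *)
move=> k_gt0; pose L := 16 * k + 8.
have [C C_gt0 HC] := @sparse_or_dense_subset k (fun i j => (j == i.+1) == true)
  _ (fun=> L) 0 k_gt0 erefl.
exists C => // G X free X_gt1; have [ltXC|leCX] := ltnP #|X| C.
  have [x [y [xX yX xy]]] := card_gt1P X_gt1.
  exists (edge x y), [set x], [set y]; rewrite !sub1set !cards1 muln1 (ltnW ltXC).
  by split=> // u v /set1P-> /set1P->; rewrite /bedge xy eqxx.
have [m [b [U [Xm _ UX cU vU]]]] := HC G X (free true) leCX.
have m_gt0 : 0 < m by move: Xm X_gt1; case: (m) => //; rewrite muln0 leqn0 => /eqP->.
pose r : rel G := bedge b.
have [/has_separatedP[A [B [[AX BX dAB] [mA mB /separatedP sAB]]]]|/negP nsep] :=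
    boolP (has_separated r m U).
  exists (~~ b), A, B; split; try exact: subset_trans UX.
  - by apply: leq_trans Xm _; rewrite leq_mul2l mA orbT.
  - by apply: leq_trans Xm _; rewrite leq_mul2l mB orbT.
  - move=> x y xA yB; rewrite bedgeN (sAB x y) // andbT.
    by apply: contraTneq yB => <-; rewrite (disjointFr dAB).
(* By the volume bound [3 * L * m ^ 2], at most half of [U] has degree above [6 * m]. *)
pose Z := [set x in U | #|nbh r U x| <= 6 * m].
have ZU : Z \subset U by apply/subsetP=> x; rewrite inE => /andP[].
have cZ : 2 * #|Z| >= L * m.
  have h1 : #|U :\: Z| * (6 * m) <= 3 * L * m ^ 2.
    apply: leq_trans vU; rewrite -sum_nat_const /volume [leqRHS](big_setID Z) /=.
    apply: leq_trans _ (leq_addl _ _); apply: leq_sum => x.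
    by rewrite !inE; case: (x \in U); rewrite ?andbF //= andbT -ltnNge => /ltnW.
  have h2 : #|U :\: Z| * 2 <= L * m.
    have h : 0 < 3 * m by rewrite muln_gt0.
    by rewrite -(leq_pmul2r h); apply: leq_trans (leq_trans _ h1) _; nia.
  have : #|U :\: Z| + #|Z| = #|U|.
    by rewrite addnC (cardsD U Z) (setIidPr ZU) subnKC // subset_leq_card.
  by rewrite cU; lia.
have nsepZ : ~ has_separated r m Z by move=> /(has_separatedS ZU).
have [|W [WZ conW leW _]] := connected_large (bedge_sym b) m_gt0 _ nsepZ.
  by rewrite /L in cZ; nia.
have [w wW] : exists w, w \in W.
  by apply/set0Pn; rewrite -card_gt0; rewrite /L in cZ; nia.
have [|||p [_ _ Hp]] := @induced_path_from _ r (6 * m) m k.-1 W w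
    (bedge_sym b) (bedge_irrefl b) m_gt0 _ _ conW wW.
- move=> x /(subsetP WZ); rewrite inE => /andP[_]; apply: leq_trans.
  by rewrite subset_leq_card ?nbhS // (subset_trans WZ).
- by move=> /(has_separatedS WZ).
- by rewrite /L in cZ; case: (k) k_gt0 cZ => // k' _; nia.
case: (free b p) => i j /andP[ltij ltjk]; have [|pij rij] := Hp i j.
  by rewrite ltij -ltnS prednK.
move: rij; case: (j == i.+1) => rij; first by rewrite -[_ == b]/(b).
by rewrite -[_ == b]/(~~ b) bedgeN pij -/r rij.
Qed.

(** * Recursive construction of separating families *)

Lemma double_expn_leq n : 2 * n ^ n.+1 <= n.+1 ^ n.+1.
Proof.
case: n => // n; set m := n.+1.
(* Bernoulli's inequality for [1 + 1 / m], cleared of denominators; it is applied with [j = m]. *)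
have bern j : m ^ j.+1 + j.+1 * m ^ j <= m.+1 ^ j.+1.
  elim: j => [|j IH]; first by rewrite !expn1 expn0 muln1 addn1.
  rewrite (expnS m.+1) !(expnS m j.+1); apply: leq_trans (leq_mul (leqnn _) IH).
  by rewrite expnS; nia.
by apply: leq_trans (bern m); rewrite mul2n -addnn leq_add2l expnS leq_mul2r leqnSn orbT.
Qed.

(** A cut is encoded by its clique side. Only the traces of [K] and [S] on [X] are to be separated,
    which suits the recursion on [X]. *)
Definition separating_family (G : graph) (X : {set G}) (F : seq {set G}) :=
  forall K S : {set G}, clique K -> stable_set S -> K :&: S = set0 ->
  exists2 C, C \in F & K :&: X \subset C /\ [disjoint S :&: X & C].

(** A stable set misses one side of a complete pair, and a clique one side of an anticomplete pair.
    The missed side can be deleted from [X] and afterwards put wholly with [K] in the first case,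
    with [S] in the second. *)
Lemma separating_family_exists k : 0 < k -> exists N,
  forall (G : graph) (X : {set G}), induced_path_free k G -> 0 < #|X| ->
  exists2 F, separating_family X F & size F <= 2 * #|X| ^ N.
Proof.
move=> k_gt0; have [[//|M] _ HM] := pure_pair k_gt0; exists M.+1 => G X free.
have [n] := ubnP #|X|; elim: n X => // n IH X; rewrite ltnS => leXn X_gt0.
have [leX1|X_gt1] := leqP #|X| 1.
  exists [:: setT; set0]; last by rewrite leq_pmulr // expn_gt0 X_gt0.
  have /cards1P[x ->] : #|X| == 1 by rewrite eqn_leq leX1.
  move=> K S _ _ KS; have [xK|xK] := boolP (x \in K).
    exists setT; rewrite ?inE ?eqxx // subsetT; split=> //.
    rewrite disjoints_subset; apply/subsetP=> y; rewrite !inE => /andP[yS /eqP yx].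
    by have /setP/(_ x) := KS; rewrite !inE xK -yx yS.
  exists set0; rewrite ?inE ?eqxx ?orbT //; split; last first.
    by rewrite disjoint_sym disjoints_subset sub0set.
  apply/subsetP=> y; rewrite !inE => /andP[yK /eqP yx].
  by rewrite -yx yK in xK.
have [b [A [B [AX BX cA cB AB]]]] := HM G X free X_gt1.
have A_gt0 : 0 < #|A| by case: #|A| cA => //; rewrite muln0; lia.
have B_gt0 : 0 < #|B| by case: #|B| cB => //; rewrite muln0; lia.
have dAB : [disjoint A & B].
  rewrite disjoints_subset; apply/subsetP=> x xA; rewrite inE; apply/negP=> xB.
  by have := AB x x xA xB; rewrite bedge_irrefl.
have cXA : #|X :\: A| + #|A| = #|X|.
  by rewrite addnC (cardsD X A) (setIidPr AX) subnKC // subset_leq_card.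
have cXB : #|X :\: B| + #|B| = #|X|.
  by rewrite addnC (cardsD X B) (setIidPr BX) subnKC // subset_leq_card.
have XA_gt0 : 0 < #|X :\: A|.
  apply: leq_trans B_gt0 _; rewrite subset_leq_card // subsetD BX.
  by rewrite disjoint_sym.
have XB_gt0 : 0 < #|X :\: B|.
  by apply: leq_trans A_gt0 _; rewrite subset_leq_card // subsetD AX.
have [|FA sepA cFA] := IH (X :\: A) _ XA_gt0; first by lia.
have [|FB sepB cFB] := IH (X :\: B) _ XB_gt0; first by lia.
(* With [N = M.+1], [(1 - 1 / N) ^ N <= 1 / 2], so each recursive family takes at most half of the
   allowed size. *)
have halve (Y : {set G}) :
    M.+1 * #|Y| <= M * #|X| -> 4 * #|Y| ^ M.+1 <= 2 * #|X| ^ M.+1.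
  move=> leY; have M_gt0 : 0 < M.+1 ^ M.+1 by rewrite expn_gt0.
  have h1 : M.+1 ^ M.+1 * #|Y| ^ M.+1 <= M ^ M.+1 * #|X| ^ M.+1.
    by rewrite -!expnMn leq_exp2r.
  rewrite -(leq_pmul2l M_gt0); have h2 := double_expn_leq M.
  move: h1 h2; move: (M.+1 ^ M.+1) (M ^ M.+1) (#|X| ^ _) (#|Y| ^ _) => a c d e.
  by nia.
have boundA : 4 * #|X :\: A| ^ M.+1 <= 2 * #|X| ^ M.+1 by apply: halve; nia.
have boundB : 4 * #|X :\: B| ^ M.+1 <= 2 * #|X| ^ M.+1 by apply: halve; nia.
pose ext (Z C : {set G}) := if b then C :|: Z else C :\: Z.
exists ([seq ext A C | C <- FA] ++ [seq ext B C | C <- FB]); last first.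
  by rewrite size_cat !size_map; lia.
have extend (Z : {set G}) F K S : separating_family (X :\: Z) F ->
    clique K -> stable_set S -> K :&: S = set0 ->
    [disjoint (if b then S else K) & Z] ->
    exists2 C, C \in [seq ext Z C | C <- F] &
      K :&: X \subset C /\ [disjoint S :&: X & C].
  move=> sepF cK sS KS dZ; have [C CF [KC SC]] := sepF K S cK sS KS.
  exists (ext Z C); first exact: map_f.
  split.
    apply/subsetP=> x /setIP[xK xX]; have := subsetP KC x; rewrite /ext !inE xK xX.
    move: dZ; case: (b) => dZ; rewrite !inE; first by case: (x \in Z); rewrite ?orbT // orbF; apply.
    by rewrite (disjointFr dZ xK); apply.
  rewrite disjoints_subset; apply/subsetP=> x /setIP[xS xX].
  have := disjointFr SC (x := x); rewrite /ext !inE xS xX.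
  move: dZ; case: (b) => dZ; rewrite !inE.
    by rewrite (disjointFr dZ xS) orbF => ->.
  by case: (x \in Z) => //= ->.
move=> K S cK sS KS.
have : [disjoint (if b then S else K) & A] || [disjoint (if b then S else K) & B].
  apply: contraT; rewrite negb_or -!setI_eq0 => /andP[/set0Pn[x /setIP[xD xA]]].
  case/set0Pn=> y /setIP[yD yB]; have := AB x y xA yB; rewrite /bedge.
  move: xD yD; case: (b) => xD yD /andP[xy]; first by rewrite (negPf (sS x y xD yD)).
  by rewrite cK.
case/orP=> dZ.
  have [C CF sepC] := extend A FA K S sepA cK sS KS dZ.
  by exists C; rewrite // mem_cat CF.
have [C CF sepC] := extend B FB K S sepB cK sS KS dZ.
by exists C; rewrite // mem_cat CF orbT.
Qed.

(** * From separating families to cuts and a polynomial bound *)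

Local Open Scope ring_scope.

Theorem theorem10 (k : nat) (k_gt0 : (0 < k)%N) :
  exists Q : {poly int},
    forall G : graph,
      ~ contains_induced G (path_graph k) ->
      ~ contains_induced G (complement (path_graph k)) ->
      exists F : {set {set G} * {set G}},
        CS_separator F /\ (#|F|%:Z <= Q.[#|G|%:Z]).
Proof.
have [N HN] := separating_family_exists k_gt0.
(* The constant term covers the empty graph, which still needs one cut. *)
exists (2%:P * 'X^N + 2%:P) => G noP nocoP.
have free := induced_path_freeP noP nocoP.
have [L sepL sizeL] : exists2 L, separating_family [set: G] L
    & (size L <= 2 * #|G| ^ N + 2)%N.
  have [G0|G_gt0] := posnP #|G|.
    exists [:: set0] => [K S _ _ _|]; last by rewrite addn2.
    exists set0; rewrite ?inE // -setI_eq0 setI0; split=> //.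
    by apply/subsetP=> x; have := card0_eq G0 x.
  have [|L sepL sizeL] := HN G [set: G] free; first by rewrite cardsT.
  by exists L; rewrite // (leq_trans sizeL) // cardsT leq_addr.
exists [set (C, ~: C) | C in L]; split.
  split=> [c /imsetP[C _ ->]|K S cK sS KS]; first by rewrite /is_cut setUCr setICr.
  have [C CL [KC SC]] := sepL K S cK sS KS; rewrite !setIT in KC SC.
  by exists (C, ~: C); [apply: imset_f|split=> //; rewrite -disjoints_subset].
rewrite hornerD hornerM hornerXn !hornerC -[#|G|%:Z]natz -natrX -natrM.
rewrite -natrD natz lez_nat.
apply: leq_trans (leq_imset_card _ _) _.
exact: leq_trans (card_size _) sizeL.
Qed.
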